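(* Consider a pair of genuinely incompatible observables $A_1=X_dZ_d^{l}$, with $l\in\{0,\dots,d-1\}$, and $A_2=Z_d$ on $\mathbb{C}^d$, and assume that the corresponding steering inequality $$\mathcal{B}_{d,2}:=\sum_{i=1}^{2}\sum_{k=1}^{d-1}\langle A_i^k\otimes B_i^k\rangle\le\sqrt2\,(d-1)$$ is violated by a state $|\psi\rangle\in\mathbb{C}^d\otimes\mathcal{H}_B$ and observables $B_i$ ($i=1,2$) acting on $\mathcal{H}_B$ such that $\mathcal{B}_{d,2}\ge 2(d-1)-\varepsilon$. Then there exists a unitary $U_B:\mathcal{H}_B\to\mathcal{H}_B$ such that $$\Big\|(\mathbb{1}\otimes U_B)(\mathbb{1}\otimes B_i^{k})|\psi\rangle-\big(\mathbb{1}\otimes (B_i')^{k}\big)|\phi_d^+\rangle\Big\|\le\sqrt{2\varepsilon}+2\sqrt d\,\sqrt[4]{2\varepsilon}$$ and $$\Big\|U_BB_i^{k}U_B^{\dagger}-(B_i')^{k}\Big\|_2\le\sqrt d\,\Big(\sqrt{2\varepsilon}+4\sqrt d\,\sqrt[4]{2\varepsilon}\Big)$$ for $i=1,2$ and $k=0,\dots,d-1$, where $B_i'=A_i^*$ are Bob's ideal observables and $\|\cdot\|_2$ is the Hilbert–Schmidt norm.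
   Context: Let $\omega=e^{2\pi\mathrm{i}/d}$. $X_d$ and $Z_d$ are the generalized Pauli matrices on $\mathbb{C}^d$: $X_d|i\rangle=|i+1\rangle$ (addition modulo $d$) and $Z_d|i\rangle=\omega^i|i\rangle$, where $\{|i\rangle\}_{i=0}^{d-1}$ is the computational basis. Unitary observables $A_i$ on $\mathbb{C}^d$ obeying $A_i^d=\mathbb{1}$ are called genuinely incompatible if the only common invariant (nonzero) subspace of all the $A_i$ is the full space $\mathbb{C}^d$. The state $|\psi\rangle$ is a pure state (unit vector), $\mathcal{H}_B$ is a finite-dimensional Hilbert space, and Bob's measurements are projective, i.e. each $B_i$ is a unitary operator on $\mathcal{H}_B$ with eigenvalues among $1,\omega,\dots,\omega^{d-1}$ (so $B_i^d=\mathbb{1}$). Bob's reduced state $\rho_B=\mathrm{Tr}_A|\psi\rangle\langle\psi|$ is assumed to be of full rank on $\mathcal{H}_B$. The expectation value is $\langle A_i^k\otimes B_i^k\rangle=\langle\psi|A_i^k\otimes B_i^k|\psi\rangle$. $|\phi_d^+\rangle=\frac{1}{\sqrt d}\sum_{i=0}^{d-1}|i\rangle|i\rangle$ is the two-qudit maximally entangled state, and $A_i^*$ is the complex conjugate of $A_i$ in the computational basis. In the two bounds, Bob's factor $\mathbb{C}^d$ (on which $B_i'$ acts and in which the second factor of $|\phi_d^+\rangle$ lives) is compared with $\mathcal{H}_B$ by identifying its computational basis with orthonormal vectors of $\mathcal{H}_B$. *)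

(* Defs.v *)
From mathcomp Require Import all_boot all_order all_algebra.
From mathcomp Require Import spectral.
From mathcomp Require Import complex mxtens.
From mathcomp Require Import reals trigo.

Set Implicit Arguments.
Unset Strict Implicit.
Unset Printing Implicit Defensive.

Import Order.TTheory GRing.Theory Num.Theory.

Local Open Scope ring_scope.
Local Open Scope complex_scope.
Local Open Scope sesquilinear_scope.

(* Kets are column vectors.  C^d (x) C^n is 'cV_(d * n), with |a>|j> at position
   mxtens_index (a, j), in accordance with the Kronecker product *t of mxtens. *)

Section Definitions.
Context {R : realType}.
Local Notation C := R[i].

Definition omega (d : nat) : C :=
  cos (2 * pi / d%:R) +i* sin (2 * pi / d%:R).

Definition pauliX (d : nat) : 'M[C]_d :=
  \matrix_(i, j) (i == j.+1 %% d :> nat)%N%:R.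

Definition pauliZ (d : nat) : 'M[C]_d :=
  diag_mx (\row_i omega d ^+ i).

Definition alice (d l : nat) (i : 'I_2) : 'M[C]_d :=
  if i == 0 then pauliX d *m pauliZ d ^+ l else pauliZ d.

(* The invariant-subspace condition alone: unitarity and A_i^d = 1 are kept
   separate from it. *)
Definition genuinely_incompatible (d m : nat) (A : 'I_m -> 'M[C]_d) : Prop :=
  forall W : {vspace 'cV[C]_d},
    W != 0%VS -> (forall i v, v \in W -> A i *m v \in W) -> W = fullv.

(* A projective d-outcome measurement sum_a omega^a P_a, encoded as an operator. *)
Definition projective_observable (d n : nat) (B : 'M[C]_n) : Prop :=
  B \is unitarymx /\
  forall a, eigenvalue B a -> exists j : 'I_d, a = omega d ^+ j.

Definition expectation (n : nat) (psi : 'cV[C]_n) (M : 'M[C]_n) : C :=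
  (psi^t* *m M *m psi) 0 0.

(* A complex number; it is real as soon as A_i^d = B_i^d = 1, the terms k and
   d - k being conjugate. *)
Definition steering_value (d n m : nat) (A : 'I_m -> 'M[C]_d)
    (B : 'I_m -> 'M[C]_n) (psi : 'cV[C]_(d * n)) : C :=
  \sum_(i < m) \sum_(1 <= k < d) expectation psi (A i ^+ k *t B i ^+ k).

(* Bob holds the second tensor factor, so the first one is traced out. *)
Definition reduced_state (d n : nat) (psi : 'cV[C]_(d * n)) : 'M[C]_n :=
  \matrix_(i, j) \sum_(a < d)
    (psi *m psi^t*) (mxtens_index (a, i)) (mxtens_index (a, j)).

Definition max_entangled (d : nat) : 'cV[C]_(d * d) :=
  (Num.sqrt d%:R)^-1%:C *:
    \sum_(i < d) delta_mx (mxtens_index (i, i)) 0.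

Definition ket_norm (n : nat) (v : 'cV[C]_n) : R :=
  Num.sqrt (complex.Re ((v^t* *m v) 0 0)).

Definition HS_norm (n : nat) (M : 'M[C]_n) : R :=
  Num.sqrt (complex.Re (\tr (M^t* *m M))).

(* V : C^d -> C^n maps the computational basis to orthonormal vectors. *)
Definition isometric_embedding (d n : nat) (V : 'M[C]_(n, d)) : Prop :=
  V^t* *m V = 1%:M.

End Definitions.

(* Main.v *)
(** Write |psi> = sum Psi_(j,a) |a>|j>, so that (M (x) N)|psi> corresponds to the
    matrix N Psi M^T. Full rank of rho_B and the isometry V force dim H_B = d, and
    Psi is invertible. Let D_i be the entrywise conjugate of A_i. Each of the
    2(d-1) terms of the steering value has real part at most 1, hence at least
    1 - eps, which says that B_i^k Psi and Psi D_i^k are delta-close in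
    Hilbert-Schmidt norm, delta = sqrt (2 eps). So Psi^t* Psi is 2 delta-close to
    its conjugates by the D_i^k; averaging over the d^2 products D_2^j D_1^k, a
    complete twirl, makes it 4 delta-close to the scalar matrix 1/d. In the polar
    decomposition Psi = W P this brings P close to 1/sqrt d, and U = V W^t* is the
    required unitary. *)

Require Import Defs.
From mathcomp Require Import all_boot all_order all_algebra.
From mathcomp Require Import spectral.
From mathcomp Require Import complex mxtens.
From mathcomp Require Import reals trigo.
From mathcomp Require Import ring lra.

Set Implicit Arguments.
Unset Strict Implicit.

Import Order.TTheory GRing.Theory Num.Theory.

Local Open Scope ring_scope.
Local Open Scope complex_scope.
Local Open Scope sesquilinear_scope.

(** * The Frobenius norm *)

Section FrobeniusNorm.
Context {R : realType}.
Local Notation C := R[i].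

(** One norm standing for both [ket_norm] and [HS_norm]; the rectangular type covers kets and the
    coefficient matrices of bipartite kets. *)
Definition frob {m n} (M : 'M[C]_(m, n)) : R :=
  Num.sqrt (complex.Re (\tr (M^t* *m M))).

(** Flattening a matrix makes this the norm of a Hermitian inner product, so the triangle inequality
    is inherited. *)
Lemma frob_dot m n (M : 'M[C]_(m, n)) :
  \tr (M^t* *m M) = dotmx (mxvec M) (mxvec M).
Proof.
rewrite dotmxE mxE (reindex _ (curry_mxvec_bij _ _)) /=.
rewrite [RHS](eq_bigr (fun p => `|M p.1 p.2| ^+ 2)); last first.
  by move=> [i j] _ /=; rewrite !mxE mxvecE normCK.
rewrite -(pair_bigA _ (fun i j => `|M i j| ^+ 2)) exchange_big.
apply: eq_bigr => j _ /=; rewrite mxE; apply: eq_bigr => i _.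
by rewrite !mxE mulrC normCK.
Qed.

Lemma frobE m n (M : 'M[C]_(m, n)) :
  (frob M)%:C = sqrtC (dotmx (mxvec M) (mxvec M)).
Proof.
rewrite /frob frob_dot.
set x : C := dotmx _ _; have x0 : 0 <= x := dnorm_ge0 (@dotmx C _) _.
apply/eqP; rewrite -(@eqrXn2 _ 2) // ?ler0c ?sqrtr_ge0 ?sqrtC_ge0 //.
rewrite sqrtCK -rmorphXn /= sqr_sqrtr ?RRe_real ?ger0_real //.
by move: x0; rewrite lecE => /andP[].
Qed.

Lemma frob_ge0 m n (M : 'M[C]_(m, n)) : 0 <= frob M.
Proof. exact: sqrtr_ge0. Qed.

Lemma sqr_frob m n (M : 'M[C]_(m, n)) : (frob M ^+ 2)%:C = \tr (M^t* *m M).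
Proof. by rewrite rmorphXn /= frobE sqrtCK frob_dot. Qed.

Lemma sqr_frob_sum m n (M : 'M[C]_(m, n)) :
  (frob M ^+ 2)%:C = \sum_i \sum_j `|M i j| ^+ 2.
Proof.
rewrite sqr_frob exchange_big; apply: eq_bigr => j _ /=.
by rewrite mxE; apply: eq_bigr => i _; rewrite !mxE mulrC -normCK.
Qed.

Lemma frobD m n (M N : 'M[C]_(m, n)) : frob (M + N) <= frob M + frob N.
Proof.
rewrite -lecR rmorphD /= !frobE linearD.
by have [] := triangle_lerif (@dotmx C _) (mxvec M) (mxvec N).
Qed.

Lemma frobZ m n a (M : 'M[C]_(m, n)) : (frob (a *: M))%:C = `|a| * (frob M)%:C.
Proof.
apply/eqP; rewrite -(@eqrXn2 _ 2) ?mulr_ge0 ?normr_ge0 ?ler0c ?frob_ge0 //.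
rewrite exprMn -[_ ^+ 2]rmorphXn -[(frob M)%:C ^+ 2]rmorphXn /= !sqr_frob_sum.
rewrite mulr_sumr; apply/eqP/eq_bigr => i _.
by rewrite mulr_sumr; apply: eq_bigr => j _; rewrite mxE normrM exprMn.
Qed.

Lemma frobZr m n (a : R) (M : 'M[C]_(m, n)) : 0 <= a ->
  frob (a%:C *: M) = a * frob M.
Proof.
by move=> a0; apply: complexI; rewrite frobZ rmorphM /= ger0_norm ?ler0c.
Qed.

Lemma frobN m n (M : 'M[C]_(m, n)) : frob (- M) = frob M.
Proof. by apply: complexI; rewrite -scaleN1r frobZ normrN1 mul1r. Qed.

Lemma frob_trmxC m n (M : 'M[C]_(m, n)) : frob (M^t*) = frob M.
Proof.
apply/eqP; rewrite -(@eqrXn2 _ 2) ?frob_ge0 // -(inj_eq (@complexI _)).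
rewrite !sqr_frob_sum exchange_big; apply/eqP/eq_bigr => j _ /=.
by apply: eq_bigr => i _; rewrite !mxE norm_conjC.
Qed.

Lemma frob0 m n : frob (0 : 'M[C]_(m, n)) = 0.
Proof. by rewrite /frob mulmx0 mxtrace0 /= sqrtr0. Qed.

Lemma frob_sum m n I (r : seq I) (P : pred I) (F : I -> 'M[C]_(m, n)) :
  frob (\sum_(i <- r | P i) F i) <= \sum_(i <- r | P i) frob (F i).
Proof.
elim/big_rec2: _ => [|i x y _ le_xy]; first by rewrite frob0.
by apply: le_trans (frobD _ _) _; rewrite lerD2l.
Qed.

Lemma unitarymx_mulVmx n (U : 'M[C]_n) : U \is unitarymx -> U^t* *m U = 1%:M.
Proof. by rewrite -trmxC_unitary => /unitarymxP; rewrite trmxCK. Qed.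

Lemma unitarymx_trmxC n (U : 'M[C]_n) : U \is unitarymx -> U^t* \is unitarymx.
Proof. by rewrite trmxC_unitary. Qed.

Lemma frobUl m n (U : 'M[C]_m) (M : 'M[C]_(m, n)) :
  U \is unitarymx -> frob (U *m M) = frob M.
Proof.
move=> Uu; rewrite /frob trmx_mul map_mxM -mulmxA (mulmxA _ U).
by rewrite unitarymx_mulVmx // mul1mx.
Qed.

Lemma frobUr m n (U : 'M[C]_n) (M : 'M[C]_(m, n)) :
  U \is unitarymx -> frob (M *m U) = frob M.
Proof.
move=> Uu; rewrite -frob_trmxC trmx_mul map_mxM.
by rewrite (frobUl _ (unitarymx_trmxC Uu)) frob_trmxC.
Qed.

(** Cauchy-Schwarz for row i of [M] against column j of [N] bounds the squared modulus of the entry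
    (i, j); the sum over i and j then factors. *)
Lemma frobM m n p (M : 'M[C]_(m, n)) (N : 'M[C]_(n, p)) :
  frob (M *m N) <= frob M * frob N.
Proof.
rewrite -ler_sqr ?nnegrE ?mulr_ge0 ?frob_ge0 // [leRHS]exprMn -lecR [leRHS]rmorphM /=.
rewrite -(frob_trmxC N) !sqr_frob_sum mulr_suml ler_sum // => i _.
rewrite mulr_sumr ler_sum // => j _.
pose u := row i M; pose v := (col j N)^t*.
have : `|dotmx u v| ^+ 2 <= dotmx u u * dotmx v v.
  by have [] := CauchySchwarz (@dotmx C _) u v.
rewrite !dotmxE [X in `|X|](_ : _ = (M *m N) i j); last first.
  by rewrite !mxE; apply: eq_bigr => k _; rewrite !mxE conjCK.
move=> /le_trans; apply; rewrite le_eqVlt; apply/orP; left; apply/eqP.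
by rewrite !mxE; congr (_ * _); apply: eq_bigr => k _; rewrite !mxE -normCK.
Qed.

End FrobeniusNorm.

(** * Bipartite kets as matrices *)

Section Bipartite.
Context {R : realType}.
Local Notation C := R[i].

Lemma ket_normE n (v : 'cV[C]_n) : ket_norm v = frob v.
Proof. by rewrite /ket_norm /frob trace_mx11. Qed.

Local Opaque frob.

Lemma unitarymxX n (U : 'M[C]_n) k : U \is unitarymx -> U ^+ k \is unitarymx.
Proof.
move=> Uu; elim: k => [|k IH]; last by rewrite exprS; exact: mul_unitarymx Uu IH.
by apply/unitarymxP; rewrite expr0 trmx1 map_mx1 mulmx1.
Qed.

Lemma tensmx1 d n : 1%:M *t 1%:M = 1%:M :> 'M[C]_(d * n).
Proof.
apply/matrixP => x y.
case: (mxtens_indexP x) => a i; case: (mxtens_indexP y) => b j.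
rewrite tensmxE !mxE (inj_eq (can_inj (@mxtens_indexK d n))) xpair_eqE.
by rewrite -natrM mulnb.
Qed.

Lemma tensmx_unitary d n (M : 'M[C]_d) (N : 'M[C]_n) :
  M \is unitarymx -> N \is unitarymx -> M *t N \is unitarymx.
Proof.
move=> /unitarymxP MM /unitarymxP NN; apply/unitarymxP.
by rewrite trmx_tens map_mxT tensmx_mul MM NN tensmx1.
Qed.

(** Turns an expectation value close to 1 into closeness of vectors: both squared norms are 1, and
    the two cross terms are conjugate. *)
Lemma frob_unitary_sub n (U : 'M[C]_n) (v : 'cV[C]_n) :
  U \is unitarymx -> frob v = 1 ->
  frob (U *m v - v) ^+ 2 = 2 * (1 - complex.Re (expectation v U)).
Proof.
move=> Uu v1; have vv : v^t* *m v = 1%:M.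
  apply/matrixP => i j; rewrite !ord1 -trace_mx11 -sqr_frob v1 expr1n.
  by rewrite !mxE.
apply: complexI; rewrite sqr_frob trace_mx11.
have -> : (U *m v - v)^t* = v^t* *m U^t* - v^t*.
  by rewrite -map_mxM -trmx_mul -map_mxB; congr map_mx; exact: linearB.
rewrite mulmxBl !mulmxBr mulmxA -(mulmxA _ (U^t*)) unitarymx_mulVmx // mulmx1 vv.
have -> : v^t* *m U^t* *m v = (v^t* *m U *m v)^t*.
  by rewrite !trmx_mul !map_mxM trmxCK mulmxA.
rewrite /expectation [v^t* *m (U *m v)]mulmxA; move: (v^t* *m U *m v) => X.
rewrite !mxE eqxx rmorphM rmorphB !rmorph1 /= complexRe ReE.
rewrite (rmorph_nat (real_complex R)) mulrBr mulr1 mulrCA divff ?pnatr_eq0 // mulr1.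
ring.
Qed.

Lemma sum_mxtens d n (F : 'I_(d * n) -> C) :
  \sum_k F k = \sum_(a < d) \sum_(j < n) F (mxtens_index (a, j)).
Proof.
rewrite pair_bigA (reindex (@mxtens_index d n)) /=.
  by apply: eq_bigr => -[].
apply: onW_bij; exists (@mxtens_unindex d n).
  exact: mxtens_indexK.
exact: mxtens_unindexK.
Qed.

Definition ket_mx {d n} (psi : 'cV[C]_(d * n)) : 'M[C]_(n, d) :=
  \matrix_(j, a) psi (mxtens_index (a, j)) 0.

Lemma ket_mx_tens d n p q (M : 'M[C]_(p, d)) (N : 'M[C]_(q, n)) psi :
  ket_mx ((M *t N) *m psi) = N *m ket_mx psi *m M^T.
Proof.
apply/matrixP => j a; rewrite !mxE sum_mxtens; apply: eq_bigr => b _.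
rewrite !mxE mulr_suml; apply: eq_bigr => k _.
by rewrite !mxE !mxtens_indexK; ring.
Qed.

Lemma ket_mx_tens1 d n p q (M : 'M[C]_(q, p)) (N : 'M[C]_(p, n)) psi :
  ket_mx ((1%:M *t M) *m (1%:M *t N) *m psi) = M *m N *m ket_mx psi :> 'M_(q, d).
Proof. by rewrite -mulmxA !ket_mx_tens !trmx1 !mulmx1 mulmxA. Qed.

Lemma ket_mxB d n (u v : 'cV[C]_(d * n)) :
  ket_mx (u - v) = ket_mx u - ket_mx v.
Proof. by apply/matrixP => j a; rewrite !mxE. Qed.

Lemma frob_ket_mx d n (psi : 'cV[C]_(d * n)) : frob (ket_mx psi) = ket_norm psi.
Proof.
apply/eqP; rewrite ket_normE -(@eqrXn2 _ 2) ?frob_ge0 //.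
rewrite -(inj_eq (@complexI _)) !sqr_frob_sum sum_mxtens exchange_big.
by apply/eqP/eq_bigr => a _; apply: eq_bigr => j _; rewrite big_ord1 !mxE.
Qed.

Lemma ket_mx_max_entangled d :
  ket_mx (max_entangled d) = ((Num.sqrt d%:R)^-1)%:C%:M.
Proof.
apply/matrixP => j a; rewrite !mxE summxE (bigD1 j) //= mxE.
rewrite (inj_eq (can_inj (@mxtens_indexK d d))) xpair_eqE eqxx !andbT.
rewrite big1 ?addr0 => [|k /negPf kj]; last first.
  by rewrite mxE (inj_eq (can_inj (@mxtens_indexK d d))) xpair_eqE (eq_sym j k) kj andbF.
by rewrite eq_sym mulr_natr.
Qed.

Lemma reduced_stateE d n (psi : 'cV[C]_(d * n)) :
  reduced_state psi = ket_mx psi *m (ket_mx psi)^t*.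
Proof.
apply/matrixP => i j; rewrite !mxE; apply: eq_bigr => a _.
by rewrite !mxE big_ord1 !mxE.
Qed.

(** The conjugate of [M] is the inverse of the unitary [M^T], so multiplying the left-hand
    difference by [M^T] on the right moves Alice's operator across without changing the norm. *)
Lemma frob_intertwine d n (M : 'M[C]_d) (N : 'M[C]_n) (psi : 'cV[C]_(d * n)) :
  M \is unitarymx ->
  frob (N *m ket_mx psi - ket_mx psi *m map_mx Num.conj M)
  = ket_norm ((M *t N) *m psi - psi).
Proof.
move=> Mu; rewrite -frob_ket_mx ket_mxB ket_mx_tens.
have MTu : M^T \is unitarymx by rewrite trmx_unitary.
rewrite -(frobUr _ MTu) mulmxBl -[X in _ - X]mulmxA.
by have := unitarymx_mulVmx MTu; rewrite trmxK => ->; rewrite mulmx1.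
Qed.

(** Each deficit [g i k] is half a squared norm, hence nonnegative, and the deficits sum to at most
    [eps]; so none of them exceeds [eps]. *)
Lemma steering_termwise d n m (A : 'I_m -> 'M[C]_d) (B : 'I_m -> 'M[C]_n)
    (psi : 'cV[C]_(d * n)) (eps : R) :
  (forall i, A i \is unitarymx) -> (forall i, B i \is unitarymx) ->
  ket_norm psi = 1 ->
  (m%:R * (d%:R - 1) - eps)%:C <= steering_value A B psi ->
  forall i (k : nat), (k < d)%N ->
    1 - complex.Re (expectation psi (A i ^+ k *t B i ^+ k)) <= eps.
Proof.
move=> Au Bu psi1 le_val i k lt_kd.
pose g i k := 1 - complex.Re (expectation psi (A i ^+ k *t B i ^+ k)).
have g_ge0 i' k' : 0 <= g i' k'.
  rewrite -(@pmulr_rge0 _ 2) // -frob_unitary_sub ?sqr_ge0 -?ket_normE //.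
  by rewrite tensmx_unitary ?unitarymxX.
have d_gt0 : (0 < d)%N by apply: leq_trans lt_kd.
have sum_g : \sum_i' \sum_(1 <= k' < d) g i' k' <= eps.
  have -> : \sum_i' \sum_(1 <= k' < d) g i' k' =
            m%:R * (d%:R - 1) - complex.Re (steering_value A B psi).
    rewrite /steering_value (raddf_sum (@complex.Re R : Rcomplex R -> R)).
    rewrite -[m in m%:R]card_ord -sumr_const mulr_suml -sumrB.
    apply: eq_bigr => i' _; rewrite mul1r (raddf_sum (@complex.Re R : Rcomplex R -> R)).
    by rewrite /g sumrB sumr_const_nat natrB.
  by move: le_val; rewrite lecE => /andP[_ /=]; lra.
(* The sum starts at k = 1. At k = 0 the deficit vanishes, and [eps] is nonnegative because it
   bounds a sum of nonnegative terms. *)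
have [->|k_gt0] := posnP k.
  have -> : expectation psi (A i ^+ 0 *t B i ^+ 0) = 1.
    rewrite !expr0 tensmx1 /expectation mulmx1 -trace_mx11 -sqr_frob -ket_normE.
    by rewrite psi1 expr1n.
  by rewrite subrr (le_trans _ sum_g) // sumr_ge0 // => *; exact: sumr_ge0.
rewrite -/(g i k); clearbody g; apply: le_trans sum_g.
have k_in : k \in index_iota 1 d by rewrite mem_index_iota k_gt0.
rewrite (bigD1 i) //= (bigD1_seq k k_in (iota_uniq _ _)) /= -addrA lerDl.
by rewrite addr_ge0 ?sumr_ge0 // => *; exact: sumr_ge0.
Qed.

End Bipartite.

(** * Generalized Pauli matrices *)

Section Pauli.
Context {R : realType}.
Local Notation C := R[i].

Lemma omegaX d k : omega d ^+ k
  = cos (k%:R * (2 * pi / d%:R)) +i* sin (k%:R * (2 * pi / d%:R)) :> C.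
Proof.
elim: k => [|k IH]; first by rewrite mul0r cos0 sin0.
rewrite exprS IH /omega; set t := 2 * pi / d%:R.
rewrite -[k.+1%:R]natr1 mulrDl mul1r cosD sinD; simpc.
by congr (_ +i* _); ring.
Qed.

Lemma omega_normC d : omega d * Num.conj (omega d) = 1 :> C.
Proof.
change ((omega d : C) * conjc (omega d : C) = 1); rewrite /omega; simpc.
by rewrite -!expr2 cos2Dsin2 [sin _ * cos _]mulrC addNr.
Qed.

Lemma omega_prim d : (0 < d)%N -> d.-primitive_root (omega d : C).
Proof.
move=> d_gt0; apply/andP; split=> //; apply/forallP => i; apply/eqP.
have d0 : d%:R != 0 :> R by rewrite pnatr_eq0 -lt0n.
rewrite unity_rootE omegaX; case: (eqVneq i.+1 d) (ltn_ord i) => [-> _|ne].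
  rewrite mulrCA divff // mulr1 mulrC mulr_natr cos2pi sin2pi.
  exact: eqxx.
rewrite leq_eqVlt (negPf ne) /= => lt_id.
(* The half-angle [t] lies strictly between 0 and pi, where the sine is positive, whereas cos(2t) =
   1 - 2 sin(t)^2 = 1 would make it vanish. *)
apply/negP => /eqP [+ _]; set t := i.+1%:R * (pi / d%:R) : R.
have -> : i.+1%:R * (2 * pi / d%:R) = t *+ 2.
  by rewrite /t -[RHS]mulr_natr; ring.
rewrite cos_mulr2n cos2sin2 => st.
have t_gt0 : 0 < t by rewrite mulr_gt0 ?divr_gt0 ?pi_gt0 ?ltr0n.
have t_lt : t < pi.
  by rewrite /t mulrCA gtr_pMr ?pi_gt0 // ltr_pdivrMr ?ltr0n // mul1r ltr_nat.
have := @sin_gt0_pi R t; rewrite t_gt0 t_lt => /(_ isT) s_gt0.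
by have := exprn_gt0 2 s_gt0; move: st; lra.
Qed.

Lemma omegaX_normC d k : omega d ^+ k * Num.conj (omega d ^+ k) = 1 :> C.
Proof. by rewrite rmorphXn -exprMn omega_normC expr1n. Qed.

Lemma diag_mxX n (r : 'rV[C]_n) k :
  diag_mx r ^+ k = diag_mx (\row_a r 0 a ^+ k).
Proof.
elim: k => [|k IH]; first by apply/matrixP => i j; rewrite expr0 !mxE.
rewrite exprS IH -mulmxE mulmx_diag; congr diag_mx.
by apply/rowP => a; rewrite !mxE exprS.
Qed.

Lemma map_mx_conjX n (A : 'M[C]_n) k :
  map_mx Num.conj (A ^+ k) = map_mx Num.conj A ^+ k.
Proof.
elim: k => [|k IH]; first by rewrite !expr0 map_mx1.
by rewrite !exprS -!mulmxE map_mxM IH.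
Qed.

Lemma pauliZ_unitary d : pauliZ d \is @unitarymx C d d.
Proof.
apply/unitarymxP; rewrite tr_diag_mx map_diag_mx mulmx_diag -diag_const_mx.
by congr diag_mx; apply/rowP => a; rewrite !mxE omegaX_normC.
Qed.

Lemma pauliXE d i j : pauliX d i j = (i == ordS j)%:R :> C.
Proof. by rewrite mxE. Qed.

Lemma pauliX_unitary d : pauliX d \is @unitarymx C d d.
Proof.
rewrite -trmxC_unitary; apply/unitarymxP; rewrite trmxCK.
apply/matrixP => i j; rewrite mxE (bigD1 (ordS i)) //= big1 => [|k /negPf ki].
  by rewrite mxE mxE !pauliXE eqxx conjC1 mul1r addr0 (inj_eq (@ordS_inj d)) !mxE.
by rewrite mxE mxE !pauliXE ki conjC0 mul0r.
Qed.

Lemma alice_unitary d l i : alice d l i \is @unitarymx C d d.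
Proof.
rewrite /alice; case: ifP => _; last exact: pauliZ_unitary.
by rewrite mul_unitarymx ?unitarymxX ?pauliX_unitary ?pauliZ_unitary.
Qed.

(** Conjugation by the j-th power multiplies the entry (a, b) by omega^(j(a - b)); the sum over j is
    d on the diagonal and a vanishing geometric sum off it. *)
Lemma pauliZ_twirl d (M : 'M[C]_d) (Z := map_mx Num.conj (pauliZ d)) :
  \sum_(j < d) (Z ^+ j)^t* *m M *m Z ^+ j = d%:R *: diag_mx (\row_a M a a).
Proof.
apply/matrixP => a b.
have d_gt0 : (0 < d)%N by apply: leq_ltn_trans (ltn_ord a).
pose r : C := omega d ^+ a * Num.conj (omega d ^+ b).
have -> : (\sum_(j < d) (Z ^+ j)^t* *m M *m Z ^+ j) a b
          = M a b * \sum_(j < d) r ^+ j.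
  rewrite summxE mulr_sumr; apply: eq_bigr => j _.
  rewrite /Z map_diag_mx diag_mxX tr_diag_mx map_diag_mx mul_mx_diag mul_diag_mx.
  by rewrite !mxE /= -rmorphXn /= conjCK /r exprMn; ring.
rewrite !mxE; have [ab|ne] := eqVneq a b.
  have r1 : r = 1 by rewrite /r ab omegaX_normC.
  rewrite r1 -ab (eq_bigr (fun=> 1)) => [|j _]; last exact: expr1n.
  by rewrite sumr_const card_ord mulr1n mulrC.
suff -> : \sum_(j < d) r ^+ j = 0 by rewrite mulr0n !mulr0.
have omd : omega d ^+ d = 1 :> C := prim_expr_order (omega_prim d_gt0).
(* The product is r^d - 1 = 0; the other factor cannot vanish, since r = 1 would give a = b by
   primitivity of omega. *)
have /eqP : (r - 1) * \sum_(j < d) r ^+ j = 0.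
  rewrite -subrX1 /r exprMn -rmorphXn -!exprM ![(_ * d)%N]mulnC !exprM omd.
  by rewrite !expr1n rmorph1 mulr1 subrr.
rewrite mulf_eq0 => /orP[|/eqP //]; rewrite subr_eq0 => /eqP r1.
have /eqP : omega d ^+ a = omega d ^+ b :> C.
  by rewrite -[LHS]mulr1 -(omegaX_normC d b) mulrCA -/r r1 mulr1.
rewrite (eq_prim_root_expr (omega_prim d_gt0)) !modn_small // => /eqP /val_inj ab.
by rewrite ab eqxx in ne.
Qed.

(** [X] is the cyclic shift with a phase of modulus 1 in each column. Whatever l is, the phases
    cancel when a diagonal matrix is conjugated, and only the shift remains. *)
Lemma alice0_shift d l (f : 'I_d -> C) (X := map_mx Num.conj (alice d l 0)) :
  X^t* *m diag_mx (\row_a f a) *m X = diag_mx (\row_a f (ordS a)).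
Proof.
have XE i j : X i j = (i == ordS j)%:R * Num.conj (omega d ^+ j ^+ l).
  rewrite mxE /alice eqxx diag_mxX mul_mx_diag !mxE rmorphM /=.
  by rewrite conjC_nat.
have XtE i j : (X^t*) i j = (j == ordS i)%:R * (omega d ^+ i ^+ l).
  by rewrite mxE mxE XE rmorphM /= conjCK conjC_nat.
have mE i j k : (X^t* *m diag_mx (\row_a f a)) i k * X k j =
   (k == ordS i)%:R * (k == ordS j)%:R * (omega d ^+ i ^+ l)
   * Num.conj (omega d ^+ j ^+ l) * f k.
  by rewrite mul_mx_diag mxE [(\row_a0 f a0) _ _]mxE XE XtE; ring.
apply/matrixP => i j; rewrite [LHS]mxE (eq_bigr _ (fun k _ => mE i j k)).
rewrite (bigD1 (ordS j)) //= big1 => [|k /negPf kj]; last first.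
  by rewrite kj mulr0 !mul0r.
rewrite addr0 eqxx mulr1 (inj_eq (@ordS_inj d)) !mxE eq_sym.
have [->|_] := eqVneq i j; last by rewrite !mul0r.
by rewrite mul1r mulr1n rmorphXn -exprMn omegaX_normC expr1n mul1r.
Qed.

(** The first d iterates of the cyclic successor reach every index exactly once. *)
Lemma sum_ordS_iter d (f : 'I_d -> C) a :
  \sum_(k < d) f (iter k (@ordS d) a) = \sum_b f b.
Proof.
have itE k : iter k (@ordS d) a = ((a + k) %% d)%N :> nat.
  elim: k => [|k IH] /=; first by rewrite addn0 modn_small.
  by rewrite IH -addn1 modnDml addn1 addnS.
rewrite [RHS](reindex_inj (h := fun k : 'I_d => iter k (@ordS d) a)) // => k k'.
move=> /(congr1 val) /=; rewrite !itE => /eqP; rewrite eqn_modDl !modn_small //.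
by move=> /eqP /val_inj.
Qed.

(** The k-th conjugation shifts the diagonal k times, so over a full cycle each position collects
    every entry [f a] once. *)
Lemma alice0_twirl d l (f : 'I_d -> C) (X := map_mx Num.conj (alice d l 0)) :
  \sum_(k < d) (X ^+ k)^t* *m diag_mx (\row_a f a) *m X ^+ k = (\sum_a f a)%:M.
Proof.
have XkE k : (X ^+ k)^t* *m diag_mx (\row_a f a) *m X ^+ k
             = diag_mx (\row_a f (iter k (@ordS d) a)).
  elim: k => [|k IH]; first by rewrite expr0 trmx1 map_mx1 mul1mx mulmx1.
  rewrite exprSr -mulmxE trmx_mul map_mxM.
  transitivity (X^t* *m ((X ^+ k)^t* *m diag_mx (\row_a f a) *m X ^+ k) *m X).
    by rewrite !mulmxA.
  rewrite IH alice0_shift; congr diag_mx; apply/rowP => a.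
  by rewrite !mxE -iterSr.
apply/matrixP => a b; rewrite summxE !mxE; have [<-|ne] := eqVneq a b.
  rewrite mulr1n -(sum_ordS_iter _ a); apply: eq_bigr => k _.
  by rewrite XkE !mxE eqxx.
by rewrite big1 // => k _; rewrite XkE !mxE (negPf ne).
Qed.


End Pauli.

(** * Twirling and polar decomposition *)

Section Twirl.
Context {R : realType}.
Local Notation C := R[i].

(** The scalar matrix is the average of [M] over the d^2 conjugations by products of powers of [D 1]
    and [D 0], and each such conjugate is reached from [M] in two moves of length at most
    [delta]. *)
Lemma frob_sub_twirl d l (M : 'M[C]_d) (delta : R)
    (D := fun i => map_mx Num.conj (alice d l i)) :
  (0 < d)%N ->
  (forall i k, (k < d)%N ->
     frob (M - (D i ^+ k)^t* *m M *m D i ^+ k) <= delta) ->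
  frob (M - (\tr M / d%:R)%:M) <= 2 * delta.
Proof.
move=> d_gt0 near.
have Xu k : D 0 ^+ k \is unitarymx by rewrite unitarymxX ?conjC_unitary ?alice_unitary.
pose T k j := (D 0 ^+ k)^t* *m ((D 1 ^+ j)^t* *m M *m D 1 ^+ j) *m D 0 ^+ k.
have sumT : \sum_(k < d) \sum_(j < d) T k j = d%:R *: (\tr M)%:M.
  have -> : (\tr M)%:M = \sum_(k < d) (D 0 ^+ k)^t* *m diag_mx (\row_a M a a) *m D 0 ^+ k.
    by rewrite alice0_twirl.
  rewrite scaler_sumr; apply: eq_bigr => k _.
  rewrite scalemxAl scalemxAr -pauliZ_twirl mulmx_sumr mulmx_suml.
  by apply: eq_bigr => j _.
have le2 (k j : 'I_d) : frob (M - T k j) <= 2 * delta.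
  (* The intermediate point is the conjugate of [M] by [D 0 ^+ k] alone; the second move is a
     conjugated difference, whose norm is unchanged. *)
  have -> : M - T k j = (M - (D 0 ^+ k)^t* *m M *m D 0 ^+ k)
     + (D 0 ^+ k)^t* *m (M - (D 1 ^+ j)^t* *m M *m D 1 ^+ j) *m D 0 ^+ k.
    by rewrite mulmxBr mulmxBl addrA subrK.
  apply: le_trans (frobD _ _) _.
  rewrite frobUr // frobUl ?trmxC_unitary // mulr_natl mulr2n.
  by apply: lerD; exact: near.
have dd0 : 0 < d%:R * d%:R :> R by rewrite mulr_gt0 ?ltr0n.
rewrite -(ler_pM2l dd0) -frobZr ?(ltW dd0) // rmorphM /= rmorph_nat.
have -> : (d%:R * d%:R) *: (M - (\tr M / d%:R)%:M)
          = \sum_(k < d) \sum_(j < d) (M - T k j).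
  rewrite (eq_bigr _ (fun k _ => sumrB _ _ _ _)) sumrB sumT !sumr_const card_ord.
  rewrite scalerBr; congr (_ - _); first by rewrite -natrM scaler_nat mulrnA.
  rewrite !scale_scalar_mx; congr _%:M.
  by rewrite -mulrA [d%:R * (_ / _)]mulrC divfK // pnatr_eq0 -lt0n.
apply: le_trans (frob_sum _ _ _) _.
have -> : d%:R * d%:R * (2 * delta) = \sum_(k < d) \sum_(j < d) (2 * delta).
  by rewrite !sumr_const card_ord -mulrnA -[RHS]mulr_natl natrM.
apply: ler_sum => k _; apply: le_trans (frob_sum _ _ _) _.
exact: ler_sum.
Qed.

Lemma frob_diag d (t : 'I_d -> R) :
  frob (diag_mx (\row_a (t a)%:C)) = Num.sqrt (\sum_a t a ^+ 2).
Proof.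
rewrite -[LHS]ger0_norm ?frob_ge0 // -sqrtr_sqr; congr Num.sqrt; apply: complexI.
rewrite sqr_frob tr_diag_mx map_diag_mx mulmx_diag mxtrace_diag.
rewrite rmorph_sum; apply: eq_bigr => a _; rewrite !mxE rmorphXn expr2 /=.
by congr (_ * _); exact: conjc_real.
Qed.

(* Each eigenvalue r of P satisfies |r - c| <= |r^2 - c^2| / c. *)
Lemma polar_near_scalar d (Psi : 'M[C]_d) (c := (Num.sqrt d%:R)^-1 : R) :
  Psi \in unitmx -> frob Psi = 1 ->
  exists W P : 'M[C]_d, [/\ W \is unitarymx, Psi = W *m P,
    frob (P - c%:C%:M) <= Num.sqrt d%:R * frob (Psi^t* *m Psi - (c ^+ 2)%:C%:M)
    & frob (P - c%:C%:M) <= Num.sqrt 2].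
Proof.
move=> Psi_unit Psi1.
have d_gt0 : (0 < d)%N.
  rewrite lt0n; apply/eqP => d0; move: Psi1; have -> : Psi = 0.
    by apply/matrixP => i; have := ltn_ord i; rewrite [X in (_ < X)%N]d0.
  by rewrite frob0 => /eqP; rewrite eq_sym oner_eq0.
have rho_normal : Psi^t* *m Psi \is normalmx.
  by apply/normalmxP; rewrite trmx_mul map_mxM trmxCK.
have := orthomx_spectralP rho_normal.
set Q := spectralmx _; set s := spectral_diag _.
have Qu : Q \is unitarymx by exact: spectral_unitarymx.
rewrite invmx_unitary //; clearbody Q s => rhoE.
have QQ : Q *m Q^t* = 1%:M by apply/unitarymxP.
have Q'Q : Q^t* *m Q = 1%:M by apply: unitarymx_mulVmx.
have Q'u : Q^t* \is unitarymx by rewrite trmxC_unitary.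
(* In the eigenbasis of [Psi^t* *m Psi] the columns of [Phi] are orthogonal, with squared lengths
   [s]. *)
pose Phi := Psi *m Q^t*.
have PhiE : Phi^t* *m Phi = diag_mx s.
  rewrite /Phi trmx_mul map_mxM trmxCK !mulmxA -(mulmxA Q) rhoE.
  by rewrite !mulmxA QQ mul1mx -mulmxA QQ mulmx1.
have PhiQ : Phi *m Q = Psi by rewrite /Phi -mulmxA Q'Q mulmx1.
have Phi_unit : Phi \in unitmx by rewrite unitmx_mul Psi_unit unitarymx_unit.
have Phi1 : frob Phi = 1 by rewrite (frobUr _ Q'u).
clearbody Phi.
have s_ge0 a : 0 <= s 0 a.
  have := congr1 (fun X : 'M_d => X a a) PhiE; rewrite !mxE eqxx mulr1n => <-.
  by apply: sumr_ge0 => k _; rewrite !mxE mulrC -normCK exprn_ge0.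
(* These are the singular values of [Psi]; its invertibility makes them positive. *)
pose r a := Num.sqrt (complex.Re (s 0 a)).
have rr a : (r a ^+ 2)%:C = s 0 a.
  rewrite sqr_sqrtr; first by rewrite RRe_real ?ger0_real.
  by have := s_ge0 a; rewrite lecE => /andP[].
have s_neq0 a : s 0 a != 0.
  have : diag_mx s \in unitmx.
    by rewrite -PhiE unitmx_mul map_unitmx unitmx_tr Phi_unit.
  rewrite unitmxE det_diag unitfE prodf_seq_neq0 => /allP /(_ a).
  by rewrite mem_index_enum; exact.
have r_gt0 a : 0 < r a.
  rewrite lt_neqAle sqrtr_ge0 andbT eq_sym; apply: contraNneq (s_neq0 a) => r0.
  by rewrite -rr r0 expr0n.
pose Sd := diag_mx (\row_a (r a)%:C) : 'M[C]_d.
pose Si := diag_mx (\row_a (r a)^-1%:C) : 'M[C]_d.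
have Siherm : Si^t* = Si.
  rewrite /Si tr_diag_mx map_diag_mx; congr diag_mx; apply/rowP => a; rewrite !mxE.
  exact: conjc_real.
have SiSd : Si *m Sd = 1%:M.
  rewrite mulmx_diag -diag_const_mx; congr diag_mx; apply/rowP => a; rewrite !mxE.
  by rewrite -rmorphM /= mulVf ?gt_eqF.
clearbody Si.
have SdSi : Sd *m Si = 1%:M by apply: mulmx1C.
have SdSd : Sd *m Sd = diag_mx s.
  rewrite mulmx_diag; congr diag_mx; apply/rowP => a.
  by rewrite !mxE -rmorphM -expr2; exact: rr.
have c_gt0 : 0 < c by rewrite invr_gt0 sqrtr_gt0 ltr0n.
have cc : d%:R * c ^+ 2 = 1 by rewrite exprVn sqr_sqrtr // divff // pnatr_eq0 -lt0n.
(* Unitary invariance reduces both distances to scalar matrices to sums over the eigenvalues. *)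
have Q_diag t x : frob (Q^t* *m diag_mx (\row_a (t a)%:C) *m Q - x%:C%:M)
                 = Num.sqrt (\sum_a (t a - x) ^+ 2).
  have dE : diag_mx (\row_a (t a - x)%:C)
            = diag_mx (\row_a (t a)%:C) - x%:C%:M :> 'M[C]_d.
    rewrite -diag_const_mx -raddfB; congr diag_mx; apply/rowP => a.
    by rewrite !mxE rmorphB.
  rewrite -(frob_diag (fun a => t a - x)) dE.
  set T := diag_mx _.
  have -> : Q^t* *m T *m Q - x%:C%:M = Q^t* *m (T - x%:C%:M) *m Q.
    by rewrite mulmxBr mulmxBl -[_ *m x%:C%:M *m Q]mulmxA -scalar_mxC mulmxA Q'Q mul1mx.
  by rewrite (frobUr _ Qu) (frobUl _ Q'u).
have sumr1 : \sum_a r a ^+ 2 = 1.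
  rewrite -[RHS](expr1n _ 2) -Phi1.
  apply: complexI; rewrite sqr_frob PhiE mxtrace_diag rmorph_sum.
  by apply: eq_bigr => a _; exact: rr.
have P_near : frob (Q^t* *m Sd *m Q - c%:C%:M) = Num.sqrt (\sum_a (r a - c) ^+ 2).
  exact: Q_diag.
have rho_near : frob (Psi^t* *m Psi - (c ^+ 2)%:C%:M)
                = Num.sqrt (\sum_a (r a ^+ 2 - c ^+ 2) ^+ 2).
  rewrite -(Q_diag (fun a => r a ^+ 2)) rhoE (_ : s = \row_a (r a ^+ 2)%:C) //.
  by apply/rowP => a; rewrite mxE rr.
clearbody Sd.
(* [P] is the positive square root of [Psi^t* *m Psi], and [W] is [Psi] times the inverse of [P]. *)
exists (Phi *m Si *m Q), (Q^t* *m Sd *m Q); split.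
- rewrite -trmxC_unitary; apply/unitarymxP; rewrite trmxCK !trmx_mul !map_mxM Siherm.
  rewrite !mulmxA -[_ *m Phi]mulmxA PhiE -SdSd -!mulmxA (mulmxA Sd Si) SdSi mul1mx.
  by rewrite (mulmxA Si Sd) SiSd mul1mx Q'Q.
- rewrite !mulmxA -[_ *m Q *m Q^t*]mulmxA QQ mulmx1 -[_ *m Si *m Sd]mulmxA SiSd mulmx1.
  by rewrite PhiQ.
- rewrite P_near rho_near -sqrtrM ?ler0n //.
  rewrite ler_wsqrtr // mulr_sumr; apply: ler_sum => a _.
  (* The extra factor d (r + c)^2 is at least d c^2 = 1. *)
  have -> : d%:R * (r a ^+ 2 - c ^+ 2) ^+ 2
            = (r a - c) ^+ 2 * (d%:R * (r a + c) ^+ 2) by ring.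
  rewrite ler_peMr ?sqr_ge0 // -[leLHS]cc ler_pM2l ?ltr0n //.
  by rewrite ler_sqr ?nnegrE ?ltW ?addr_gt0 // ltrDr.
rewrite P_near ler_wsqrtr //.
(* Both the sum of the r^2 and d c^2 equal 1, and the cross term is nonpositive since all r are
   positive. *)
have -> : \sum_a (r a - c) ^+ 2 = 2 - 2 * c * \sum_a r a.
  rewrite (eq_bigr (fun a => r a ^+ 2 + c ^+ 2 - 2 * c * r a)) => [|a _]; last by ring.
  rewrite sumrB big_split /= sumr1 sumr_const card_ord.
  by rewrite -[c ^+ 2 *+ d]mulr_natl cc -mulr_sumr.
by rewrite gerBl !mulr_ge0 ?sumr_ge0 // => *; exact: ltW.
Qed.

End Twirl.

(** * Self-testing bounds *)

Section SelfTesting.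
Context {R : realType}.
Local Notation C := R[i].

Lemma frob_gram_sub m n (X Y : 'M[C]_(m, n)) :
  frob (X^t* *m X - Y^t* *m Y) <= frob (X - Y) * (frob X + frob Y).
Proof.
have -> : X^t* *m X - Y^t* *m Y = (X - Y)^t* *m X + Y^t* *m (X - Y).
  have -> : (X - Y)^t* = X^t* - Y^t* by rewrite -map_mxB; congr map_mx; exact: linearB.
  by rewrite mulmxBl mulmxBr addrA subrK.
apply: le_trans (frobD _ _) _; rewrite mulrDr; apply: lerD.
  by rewrite -(frob_trmxC (X - Y)) frobM.
by rewrite mulrC -(frob_trmxC Y) frobM.
Qed.

(** The rank n of Psi times its adjoint is at most the rank of Psi, hence at most d; the isometry is
    injective, which gives d <= n. *)
Lemma full_rank_ket_mx d n (V : 'M[C]_(n, d)) (psi : 'cV[C]_(d * n)) :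
  isometric_embedding V -> \rank (reduced_state psi) = n ->
  n = d /\ \rank (ket_mx psi) = n.
Proof.
rewrite reduced_stateE => VV rk.
have rkPsi : \rank (ket_mx psi) = n.
  by apply/eqP; rewrite eqn_leq rank_leq_row -{1}rk mxrankM_maxl.
split=> //; apply/eqP; rewrite eqn_leq -{1}rkPsi rank_leq_col /=.
by rewrite -(mxrank1 C d) -VV (leq_trans (mxrankM_maxr _ _)) ?rank_leq_row.
Qed.

(* For delta > 1/4 the trivial bound sqrt 2 <= D takes over. *)
Lemma polar_defect_le (D delta eta : R) :
  Num.sqrt 2 <= D -> 0 <= delta ->
  eta <= D * (4 * delta) -> eta <= Num.sqrt 2 ->
  eta <= 2 * D * Num.sqrt delta.
Proof.
move=> D_ge delta_ge0 le1 le2.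
have D_ge0 : 0 <= D by apply: le_trans D_ge; exact: sqrtr_ge0.
have := sqr_sqrtr delta_ge0; have := sqrtr_ge0 delta.
move: (Num.sqrt delta) => s s_ge0 sE.
(* At s = 1/2 the linear bound 4 D s^2 meets the target 2 D s. *)
have [s_le|s_gt] := lerP s 2^-1; last first.
  apply: le_trans le2 (le_trans D_ge _).
  by have := ler_wpM2l D_ge0 (ltW s_gt); lra.
apply: le_trans le1 _; rewrite -sE.
by have := ler_wpM2l (mulr_ge0 D_ge0 s_ge0) s_le; lra.
Qed.

(** Since [W^t*] takes [Psi] to [P], the error splits into the intertwining defect, costing [delta],
    and the distance of [P] from c, costing [eta]. *)
Lemma frob_ket_bound d (V W P Psi Bk D : 'M[C]_d) (c delta eta : R) :
  V \is unitarymx -> W \is unitarymx -> Bk \is unitarymx -> D \is unitarymx ->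
  Psi = W *m P ->
  frob (Bk *m Psi - Psi *m D) <= delta -> frob (P - c%:C%:M) <= eta ->
  frob (V *m W^t* *m Bk *m Psi - V *m D *m c%:C%:M) <= delta + eta.
Proof.
move=> Vu Wu Bu Du PsiE le_delta le_eta.
have WPsi : W^t* *m Psi = P by rewrite PsiE mulmxA unitarymx_mulVmx // mul1mx.
have -> : V *m W^t* *m Bk *m Psi - V *m D *m c%:C%:M
   = V *m (W^t* *m (Bk *m Psi - Psi *m D) + (P - c%:C%:M) *m D).
  rewrite [W^t* *m (_ - _)]mulmxBr [W^t* *m (Psi *m D)]mulmxA WPsi.
  by rewrite [(P - _) *m D]mulmxBl addrA subrK -scalar_mxC mulmxBr !mulmxA.
rewrite (frobUl _ Vu); apply: le_trans (frobD _ _) _.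
have W'u := unitarymx_trmxC Wu.
by apply: lerD; [rewrite (frobUl _ W'u) | rewrite (frobUr _ Du)].
Qed.

(** Replacing c by [P] in c W* Bk W recovers the ket estimate with [V] taken to be the identity, at
    the price of a second [eta]. *)
Lemma frob_observable_bound d (V W P Psi Bk D : 'M[C]_d) (c delta eta : R) :
  0 <= c ->
  V \is unitarymx -> W \is unitarymx -> Bk \is unitarymx -> D \is unitarymx ->
  Psi = W *m P ->
  frob (Bk *m Psi - Psi *m D) <= delta -> frob (P - c%:C%:M) <= eta ->
  c * frob (V *m W^t* *m Bk *m (V *m W^t*)^t* - V *m D *m V^t*) <= delta + 2 * eta.
Proof.
move=> c_ge0 Vu Wu Bu Du PsiE le_delta le_eta.
have W'u := unitarymx_trmxC Wu.
have -> : V *m W^t* *m Bk *m (V *m W^t*)^t* - V *m D *m V^t*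
   = V *m (W^t* *m Bk *m W - D) *m V^t*.
  by rewrite trmx_mul map_mxM trmxCK mulmxBr mulmxBl !mulmxA.
rewrite (frobUr _ (unitarymx_trmxC Vu)) (frobUl _ Vu) -(frobZr _ c_ge0).
have -> : c%:C *: (W^t* *m Bk *m W - D)
   = (1%:M *m W^t* *m Bk *m Psi - 1%:M *m D *m c%:C%:M)
     - W^t* *m Bk *m W *m (P - c%:C%:M).
  rewrite !mul1mx [_ *m (P - _)]mulmxBr -(mulmxA _ W P) -PsiE !mul_mx_scalar.
  by rewrite opprB scalerBr [RHS]addrC addrA subrK.
apply: le_trans (frobD _ _) _; rewrite frobN mulr_natl mulr2n addrA; apply: lerD.
  apply: frob_ket_bound _ Wu Bu Du PsiE le_delta le_eta.
  by apply/unitarymxP; rewrite trmx1 map_mx1 mulmx1.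
rewrite (frobUl _ (mul_unitarymx (mul_unitarymx W'u Bu) Wu)).
exact: le_eta.
Qed.

End SelfTesting.

Theorem theorem2 (R : realType) (d l n : nat)
    (V : 'M[R[i]]_(n, d)) (psi : 'cV[R[i]]_(d * n)) (B : 'I_2 -> 'M[R[i]]_n)
    (eps : R)
    (l_lt_d : (l < d)%N)
    (incompatible : genuinely_incompatible (alice (R := R) d l))
    (V_isometry : isometric_embedding V)
    (psi_unit : ket_norm psi = 1)
    (B_projective : forall i, projective_observable d (B i))
    (full_rank : \rank (reduced_state psi) = n)
    (violation :
      (Num.sqrt 2 * (d%:R - 1))%:C < steering_value (alice d l) B psi)
    (near_maximal :
      (2 * (d%:R - 1) - eps)%:C <= steering_value (alice d l) B psi) :
  exists2 U : 'M[R[i]]_n, U \is unitarymx &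
    forall (i : 'I_2) (k : nat), (k < d)%N ->
      let B' : 'M[R[i]]_d := map_mx Num.conj (alice d l i) in
      ket_norm ((1%:M *t U) *m (1%:M *t (B i ^+ k)) *m psi
                - (1%:M *t V) *m (1%:M *t (B' ^+ k)) *m max_entangled d)
        <= Num.sqrt (2 * eps)
           + 2 * Num.sqrt d%:R * Num.sqrt (Num.sqrt (2 * eps))
      /\
      HS_norm (U *m (B i ^+ k) *m U^t* - V *m (B' ^+ k) *m V^t*)
        <= Num.sqrt d%:R
           * (Num.sqrt (2 * eps)
              + 4 * Num.sqrt d%:R * Num.sqrt (Num.sqrt (2 * eps))).
Proof.
have [n_d rkPsi] := full_rank_ket_mx V_isometry full_rank.
subst n.
(* For d = 1 the steering value and its bound are both 0, so there is no strict violation. Having d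
   >= 2 later gives sqrt 2 <= sqrt d. *)
have d_gt1 : (1 < d)%N.
  rewrite ltn_neqAle (leq_ltn_trans (leq0n l) l_lt_d) andbT.
  apply: contraTneq violation => d1; have d1R : d%:R = 1 :> R by rewrite -d1.
  rewrite d1R subrr mulr0 /steering_value big1 ?ltxx // => i _.
  by rewrite big_geq // leq_eqVlt -d1.
have d_gt0 : (0 < d)%N := ltnW d_gt1.
have Vu : V \is unitarymx by rewrite -trmxC_unitary; apply/unitarymxP; rewrite trmxCK.
have Bu i : B i \is unitarymx by have [] := B_projective i.
have Au i : alice d l i \is @unitarymx R[i] d d := alice_unitary d l i.
have BXu i k : B i ^+ k \is unitarymx := unitarymxX k (Bu i).
have near_each := steering_termwise Au Bu psi_unit near_maximal.
set Psi := ket_mx psi in rkPsi.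
have Psi_unit : Psi \in unitmx by rewrite -row_free_unit /row_free rkPsi.
have Psi1 : frob Psi = 1 by rewrite frob_ket_mx.
pose D i : 'M[R[i]]_d := map_mx Num.conj (alice d l i).
have Du i k : D i ^+ k \is unitarymx.
  by apply: unitarymxX; rewrite conjC_unitary; exact: Au.
set delta := Num.sqrt (2 * eps).
have near i k : (k < d)%N -> frob (B i ^+ k *m Psi - Psi *m D i ^+ k) <= delta.
  move=> lt_kd; have AXu := unitarymxX k (Au i).
  rewrite -map_mx_conjX (frob_intertwine _ _ AXu).
  rewrite ket_normE -[leLHS]ger0_norm ?frob_ge0 // -sqrtr_sqr ler_wsqrtr //.
  rewrite ket_normE in psi_unit.
  rewrite (frob_unitary_sub (tensmx_unitary AXu (BXu i k)) psi_unit).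
  by rewrite ler_pM2l //; exact: near_each.
set rd := Num.sqrt d%:R.
have rd_gt0 : 0 < rd by rewrite sqrtr_gt0 ltr0n.
pose c := rd^-1.
have [W [P [Wu PsiE le_lin le_triv]]] := polar_near_scalar Psi_unit Psi1.
(* The inner factor 2 comes from comparing Gram matrices of two matrices of norm 1, the outer one
   from the two moves of the twirl. *)
have rho_near : frob (Psi^t* *m Psi - (c ^+ 2)%:C%:M) <= 2 * (2 * delta).
  have -> : (c ^+ 2)%:C = \tr (Psi^t* *m Psi) / d%:R.
    rewrite -sqr_frob Psi1 expr1n exprVn sqr_sqrtr // fmorphV rmorph_nat.
    by rewrite rmorph1 mul1r.
  apply: (@frob_sub_twirl _ _ l) => // i k lt_kd.
  have -> : (D i ^+ k)^t* *m (Psi^t* *m Psi) *m D i ^+ k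
            = (Psi *m D i ^+ k)^t* *m (Psi *m D i ^+ k).
    by rewrite trmx_mul map_mxM !mulmxA.
  (* Unitarity of Bob's observable lets [B i ^+ k *m Psi] replace [Psi], so the difference of Gram
     matrices is controlled by [near]. *)
  have -> : Psi^t* *m Psi = (B i ^+ k *m Psi)^t* *m (B i ^+ k *m Psi).
    rewrite trmx_mul map_mxM -mulmxA (mulmxA _ (B i ^+ k)).
    by rewrite (unitarymx_mulVmx (BXu i k)) mul1mx.
  apply: le_trans (frob_gram_sub _ _) _.
  rewrite (frobUl _ (BXu i k)) (frobUr _ (Du i k)) Psi1.
  rewrite mulrDr !mulr1 [leRHS]mulr_natl [leRHS]mulr2n.
  exact: lerD (near i k lt_kd) (near i k lt_kd).
(* As [delta] is already a square root of 2 eps, its square root is the fourth root in the stated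
   bounds. *)
set eta := 2 * rd * Num.sqrt delta.
have P_near : frob (P - c%:C%:M) <= eta.
  apply: polar_defect_le => //; first by rewrite ler_wsqrtr // ler_nat.
    exact: sqrtr_ge0.
  apply: le_trans le_lin _; rewrite ler_pM2l //.
  by apply: le_trans rho_near _; rewrite mulrA -natrM.
exists (V *m W^t*) => [|i k lt_kd B'].
  exact: mul_unitarymx Vu (unitarymx_trmxC Wu).
split.
  rewrite -frob_ket_mx ket_mxB !ket_mx_tens1 ket_mx_max_entangled.
  exact: frob_ket_bound Vu Wu (BXu i k) (Du i k) PsiE (near i k lt_kd) P_near.
(* The factor sqrt d of the operator bound is 1/c, c being the coefficient of the maximally
   entangled state. *)
rewrite -ler_pdivrMl // -/c.
have c_ge0 : 0 <= c by rewrite invr_ge0 ltW.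
have := frob_observable_bound c_ge0 Vu Wu (BXu i k) (Du i k)
  PsiE (near i k lt_kd) P_near.
by rewrite /eta !mulrA -natrM.
Qed.
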